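(* Let $d, d_1, d_2, I_1, I_2$ be positive integers. In Game 2, Player A and Player B start with $I_1$ and $I_2$ M\&M's, respectively. In each round, Player A tosses one fair coin and eats $d$ M\&M's if her coin lands heads (and none otherwise). Player B tosses two fair coins, eating $d_1$ M\&M's if her first coin lands heads and $d_2$ M\&M's if her second coin lands heads (so $d_1+d_2$ if both land heads, and none if both land tails). All tosses are independent. Let $\mathbb{P}_{(d,d_1,d_2)}^{(2)}(I_1,I_2)$ denote the probability that Game 2 ends in a tie. Then $$\mathbb{P}_{(d, d_1, d_2)}^{(2)}(I_1, I_2) = \frac{1}{7} \sum_{(D_1, D_2) \in \mathcal{D}}\ \sum_{\substack{i, j, k \geq 0 \\ 1 \leq I_2 - d_1(i + k) - d_2(j + k) \leq D_2}}\binom{i+ j + k}{i, j, k}\, D\left(\left\lfloor \frac{I_1 - 1}{d} \right\rfloor, i + j + k, \frac{1}{7} \right),$$ where $\mathcal{D} = [d] \times [d_1, d_2, d_1 + d_2]$ (a product of multisets, summed over with multiplicity) and $i,j,k$ range over nonnegative integers.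
   Context: The game is played in rounds until, at the end of some round, at least one player has no M\&M's remaining. The game ends in a tie if both players run out of M\&M's in the same round; if exactly one player has M\&M's remaining, that player wins. If a player is ever supposed to eat more M\&M's than she has left, she eats all her remaining M\&M's. Square brackets $[\ ]$ denote multisets (repeated elements are allowed and counted with multiplicity). Thus $\mathcal{D}$ always has exactly three elements, namely $(d,d_1)$, $(d,d_2)$, $(d,d_1+d_2)$, counted with multiplicity. For integers $m,n\ge 0$ and a real number $t$, the (weighted) Delannoy number is $$D(m,n,t)=\sum_{\ell=0}^{\min(m,n)} \binom{m+n-\ell}{m-\ell,\;n-\ell,\;\ell}\, t^{\,m+n-\ell},$$ where $\binom{a+b+c}{a,b,c}=\frac{(a+b+c)!}{a!\,b!\,c!}$ is the multinomial coefficient. *)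

(* Defs.v *)
From HB Require Import structures.
From mathcomp Require Import all_boot all_order all_algebra finmap.
From mathcomp Require Import all_classical all_reals all_analysis.
From mathcomp Require Import zify.

Set Implicit Arguments.
Unset Strict Implicit.
Unset Printing Implicit Defensive.

Import Order.TTheory GRing.Theory Num.Theory.

Local Open Scope classical_set_scope.
Local Open Scope ring_scope.

Definition mutually_independent disp disp' (T : measurableType disp)
    (T' : measurableType disp') (R : realType) (P : probability T R)
    (I : choiceType) (X : I -> {RV P >-> T'}) : Prop :=
  forall (J : {fset I}) (B : I -> set T'),
    (forall i, i \in J -> measurable (B i)) ->
    P (\bigcap_(i in [set` J]) (X i @^-1` B i)) =
      (\prod_(i <- J) P (X i @^-1` B i))%E.

Variant coin := CoinA | CoinB1 | CoinB2.

Definition coin_encode (c : coin) : option bool :=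
  match c with CoinA => None | CoinB1 => Some false | CoinB2 => Some true end.

Definition coin_decode (o : option bool) : coin :=
  match o with
  | None => CoinA | Some false => CoinB1 | Some true => CoinB2
  end.

Lemma coin_encodeK : cancel coin_encode coin_decode.
Proof. by case. Qed.

HB.instance Definition _ := Finite.copy coin (can_type coin_encodeK).

(* [X (n, c)] is the toss of coin [c] in round [n] (rounds are numbered from
   0), with [true] for heads.  The tosses are defined for every [n], including
   rounds after the end of the game, where they are ignored. *)
Definition independent_fair_coins disp (T : measurableType disp)
    (R : realType) (P : probability T R)
    (X : nat * coin -> {RV P >-> bool}) : Prop :=
  mutually_independent X /\
  forall i, P [set w | X i w = true] = (2^-1 : R)%:E.

Definition game_over (s : nat * nat) : bool := (s.1 == 0%N) || (s.2 == 0%N).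

(* The truncated subtraction of [nat] implements the rule that a player
   supposed to eat more than she has left eats all that remains. *)
Definition play_round (d d1 d2 : nat) (h : coin -> bool) (s : nat * nat) :
    nat * nat :=
  ((s.1 - (if h CoinA then d else 0))%N,
   (s.2 - ((if h CoinB1 then d1 else 0) + (if h CoinB2 then d2 else 0)))%N).

Fixpoint game2_state (d d1 d2 I1 I2 : nat) (h : nat * coin -> bool) (n : nat) :
    nat * nat :=
  if n is m.+1 then
    let s := game2_state d d1 d2 I1 I2 h m in
    if game_over s then s else play_round d d1 d2 (fun c => h (m, c)) s
  else (I1, I2).

Definition game2_tie (d d1 d2 I1 I2 : nat) (h : nat * coin -> bool) : Prop :=
  exists n, game2_state d d1 d2 I1 I2 h n = (0%N, 0%N).

Definition trinomial (R : realType) (a b c : nat) : R :=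
  ((a + b + c)`!)%:R / (a`! * b`! * c`!)%:R.

Definition delannoy (R : realType) (m n : nat) (t : R) : R :=
  \sum_(l < (minn m n).+1) trinomial R (m - l) (n - l) l * t ^+ (m + n - l).

(* As a list, so that repeated pairs are kept. *)
Definition eat_pairs (d d1 d2 : nat) : seq (nat * nat) :=
  [seq (D1, D2) | D1 <- [:: d], D2 <- [:: d1; d2; (d1 + d2)%N]].

(* The lower bound 1 makes the truncation of the subtractions harmless: the
   condition agrees with the same one read in the integers. *)
Definition index_triples (d1 d2 I2 D2 : nat) : set (nat * nat * nat) :=
  [set x | let: (i, j, k) := x in
    (1 <= I2 - d1 * (i + k) - d2 * (j + k) <= D2)%N].

(* Hence a sum [\sum_(x \in index_triples d1 d2 I2 D2) _] is a genuine finite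
   sum, not the default value 0 given to sums of infinite support. *)
Lemma finite_index_triples (d1 d2 I2 D2 : nat) :
  (0 < d1)%N -> (0 < d2)%N -> finite_set (index_triples d1 d2 I2 D2).
Proof.
move=> d1_gt0 d2_gt0.
apply: (@sub_finite_set _ _ ((`I_I2.+1 `*` `I_I2.+1) `*` `I_I2.+1)).
  move=> [[i j] k] /= /andP[h _].
  have h1 : (i + k <= d1 * (i + k))%N by rewrite leq_pmull.
  have h2 : (j + k <= d2 * (j + k))%N by rewrite leq_pmull.
  by split; [split|]; lia.
by apply: finite_setX; [apply: finite_setX|]; exact: finite_II.
Qed.

(* Main.v *)
(** The tie probability [L a b] of the game started from [(a, b)] is obtained by
    conditioning on the first round: of the 8 equally likely outcomes one leaves
    the state unchanged, so [7 * L a b] is the sum of [L] over the 7 other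
    successors, and this recurrence together with the values of [L] on the final
    states determines [L].  On the other side, the Pascal recurrence for
    trinomial coefficients and the Delannoy recurrence
    [D (m+1) (n+1) = t (D m (n+1) + D (m+1) n + D m n)], with [t = 1/7], show
    that the right-hand side obeys the same recurrence: [(I1 - 1) %/ d] is the
    number of heads Player A can still toss without running out, and the pairs
    [(d, D)] list the possible last moves of a tied game. *)

Require Import Defs.
From mathcomp Require Import all_boot all_order all_algebra finmap.
From mathcomp Require Import all_classical all_reals all_analysis.
From mathcomp Require Import zify ring lra.

Set Implicit Arguments.
Unset Strict Implicit.
Unset Printing Implicit Defensive.

Import Order.TTheory GRing.Theory Num.Theory.
Import numFieldNormedType.Exports.

Local Open Scope classical_set_scope.
Local Open Scope ring_scope.

(** * Trinomial coefficients and Pascal's rule *)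

Lemma trinomial_pred (R : realType) (a b c : nat) :
  trinomial R a b c = a.+1%:R * (a + b + c)`!%:R / (a.+1`! * b`! * c`!)%:R.
Proof.
rewrite /trinomial factS -!mulnA [in RHS]natrM invfM mulrACA.
by rewrite divff ?mul1r// pnatr_eq0.
Qed.

Lemma trinomial_swap12 (R : realType) (a b c : nat) :
  trinomial R a b c = trinomial R b a c.
Proof. by rewrite /trinomial (addnC a) (mulnC a`!). Qed.

Lemma trinomial_swap13 (R : realType) (a b c : nat) :
  trinomial R a b c = trinomial R c b a.
Proof.
by rewrite /trinomial (addnC _ c) (addnC a) addnA mulnC (mulnC a`!) mulnA.
Qed.

(** Over the common denominator of [trinomial R a b c], the three terms have numerators [a], [b],
    [c] times the factorial of [a + b + c - 1]; a zero index gives the missing term. *)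
Lemma trinomial_pascal (R : realType) (a b c : nat) : (0 < a + b + c)%N ->
  trinomial R a b c =
    (if a is a'.+1 then trinomial R a' b c else 0) +
    (if b is b'.+1 then trinomial R a b' c else 0) +
    (if c is c'.+1 then trinomial R a b c' else 0).
Proof.
move=> s_gt0.
pose w x := x%:R * (a + b + c).-1`!%:R / (a`! * b`! * c`!)%:R : R.
have -> : (if a is a'.+1 then trinomial R a' b c else 0) = w a.
  by rewrite /w; case: a {s_gt0 w} => [|a]; rewrite ?mul0r// trinomial_pred.
have -> : (if b is b'.+1 then trinomial R a b' c else 0) = w b.
  rewrite /w; case: b {s_gt0 w} => [|b]; rewrite ?mul0r//.
  by rewrite trinomial_swap12 trinomial_pred addnS (addnC b) (mulnC _ a`!).
have -> : (if c is c'.+1 then trinomial R a b c' else 0) = w c.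
  rewrite /w; case: c {s_gt0 w} => [|c]; rewrite ?mul0r//.
  rewrite trinomial_swap13 trinomial_pred addnS /=.
  by rewrite (addnC _ a) (addnC c) addnA (mulnC _ a`!) (mulnC _ b`!) mulnA.
rewrite /w -!mulrDl -!natrD -natrM /trinomial; congr (_%:R / _).
by case: (a + b + c)%N s_gt0 => // s _; rewrite factS.
Qed.

(** Index shift over an unchanged range: the vanishing end terms absorb the off-by-one. *)
Lemma sum_ord_shift (V : nmodType) (N : nat) (f g : nat -> V) :
  f 0%N = 0 -> (forall i, (i.+1 < N)%N -> f i.+1 = g i) -> g N.-1 = 0 ->
  \sum_(i < N) f i = \sum_(i < N) g i.
Proof.
case: N => [|N] f0 fg gN; first by rewrite !big_ord0.
rewrite big_ord_recl big_ord_recr /= f0 gN add0r addr0.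
by apply: eq_bigr => i _; rewrite fg// /bump ltnS.
Qed.

(** Pascal's rule termwise, then a shift of [i], [j] or [k]. As [s < N - 1], no index equal to
    [N - 1] allows [i + j + k = s], so the shifts lose nothing. *)
Lemma trinomial_sumS (R : realType) (N s : nat) (phi : nat -> nat -> nat -> R) :
  (s.+1 < N)%N ->
  let T u psi := \sum_(i < N) \sum_(j < N) \sum_(k < N)
    (if (i + j + k == u)%N then trinomial R i j k * psi i j k else 0) in
  T s.+1 phi = T s (fun i j k => phi i.+1 j k) +
    T s (fun i j k => phi i j.+1 k) + T s (fun i j k => phi i j k.+1).
Proof.
move=> sN T; rewrite /T.
pose A i j k := if (i + j + k == s.+1)%N then
  (if i is i'.+1 then trinomial R i' j k else 0) * phi i j k else 0.
pose B i j k := if (i + j + k == s.+1)%N then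
  (if j is j'.+1 then trinomial R i j' k else 0) * phi i j k else 0.
pose C i j k := if (i + j + k == s.+1)%N then
  (if k is k'.+1 then trinomial R i j k' else 0) * phi i j k else 0.
transitivity (\sum_(i < N) \sum_(j < N) \sum_(k < N)
    (A i j k + B i j k + C i j k)).
  do 3 (apply: eq_bigr => ? _).
  rewrite /A /B /C; case: eqP => [e|]; last by rewrite !addr0.
  by rewrite -!mulrDl -trinomial_pascal// e.
under eq_bigr do under eq_bigr do rewrite !big_split/=.
under eq_bigr do rewrite !big_split/=.
rewrite !big_split/=; congr (_ + _ + _).
- apply: (@sum_ord_shift _ N (fun i => \sum_(j < N) \sum_(k < N) A i j k)
    (fun i => \sum_(j < N) \sum_(k < N) if (i + j + k == s)%N then
       trinomial R i j k * phi i.+1 j k else 0)).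
  + by rewrite big1// => j _; rewrite big1// => k _; rewrite /A mul0r if_same.
  + by [].
  + rewrite big1// => j _; rewrite big1// => k _.
    by case: eqP => // e; exfalso; lia.
- apply: eq_bigr => i _.
  apply: (@sum_ord_shift _ N (fun j => \sum_(k < N) B i j k)
    (fun j => \sum_(k < N) if (i + j + k == s)%N then
       trinomial R i j k * phi i j.+1 k else 0)).
  + by rewrite big1// => k _; rewrite /B mul0r if_same.
  + by move=> j _; apply: eq_bigr => k _; rewrite /B addnS.
  + by rewrite big1// => k _; case: eqP => // e; exfalso; lia.
- do 2 (apply: eq_bigr => ? _); apply: (@sum_ord_shift _ N (fun k => C _ _ k)
    (fun k => if (_ + _ + k == s)%N then
       trinomial R _ _ k * phi _ _ k.+1 else 0)).
  + by rewrite /C mul0r if_same.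
  + by move=> k _; rewrite /C addnS.
  + by case: eqP => // e; exfalso; lia.
Qed.

(** * Weighted Delannoy numbers *)

(** Gives the sums of the recurrence a common range; the guard is there because truncated
    subtraction would not make the extra terms vanish. *)
Lemma delannoyE (R : realType) (N m n : nat) (t : R) : (minn m n < N)%N ->
  delannoy m n t = \sum_(l < N)
    if (l <= m)%N && (l <= n)%N
    then trinomial R (m - l) (n - l) l * t ^+ (m + n - l) else 0.
Proof.
move=> mnN; rewrite /delannoy.
under [LHS]eq_bigr => l _.
  have -> : (trinomial R (m - l) (n - l) l * t ^+ (m + n - l) =
    if (l <= m)%N && (l <= n)%N
    then trinomial R (m - l) (n - l) l * t ^+ (m + n - l) else 0).
    by case: ifP => // /negP[]; have := ltn_ord l; lia.
  over.
rewrite (big_ord_widen N (fun l => if (l <= m)%N && (l <= n)%N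
    then trinomial R (m - l) (n - l) l * t ^+ (m + n - l) else 0)) //.
rewrite [LHS]big_mkcond; apply: eq_bigr => l _.
by case: ifPn => // h; case: ifP => // h'; exfalso; lia.
Qed.

Lemma delannoy0n (R : realType) (n : nat) (t : R) : delannoy 0 n t = t ^+ n.
Proof.
rewrite /delannoy min0n big_ord1 /trinomial !subn0 add0n addn0 mul1n muln1.
by rewrite divff ?mul1r// pnatr_eq0 -lt0n fact_gt0.
Qed.

Lemma delannoym0 (R : realType) (m : nat) (t : R) : delannoy m 0 t = t ^+ m.
Proof.
rewrite /delannoy minn0 big_ord1 /trinomial !subn0 !addn0 !muln1.
by rewrite divff ?mul1r// pnatr_eq0 -lt0n fact_gt0.
Qed.

(** Pascal's rule on the indices [m.+1 - l], [n.+1 - l], [l]: lowering the first or second gives the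
    first two Delannoy numbers, lowering the last gives the third with [l] shifted by one. *)
Lemma delannoySS (R : realType) (m n : nat) (t : R) :
  delannoy m.+1 n.+1 t =
    t * (delannoy m n.+1 t + delannoy m.+1 n t + delannoy m n t).
Proof.
set N := (m + n).+3.
rewrite !(@delannoyE _ N); try lia.
pose A l := if (l <= m)%N && (l <= n.+1)%N
    then trinomial R (m - l) (n.+1 - l) l * t ^+ (m + n.+1 - l) else 0.
pose B l := if (l <= m.+1)%N && (l <= n)%N
    then trinomial R (m.+1 - l) (n - l) l * t ^+ (m.+1 + n - l) else 0.
pose C l := if (l <= m)%N && (l <= n)%N
    then trinomial R (m - l) (n - l) l * t ^+ (m + n - l) else 0.
pose C' l := if l is l'.+1 then C l' else 0.
have -> : \sum_(l < N) C l = \sum_(l < N) C' l.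
  apply/esym/sum_ord_shift => //.
  by rewrite /C; case: ifP => // h; exfalso; lia.
rewrite -!big_split/= big_distrr/=; apply: eq_bigr => -[l /= lN] _.
rewrite /A /B.
case: (leqP l m.+1) => lm /=; last first.
  rewrite [(l <= m)%N]leqNgt (ltnW lm) /= !add0r /C' /C.
  case: l lN lm => [|l lN lm]; first by rewrite mulr0.
  by rewrite [(l <= m)%N]leqNgt -ltnS lm /= mulr0.
case: (leqP l n.+1) => ln /=; last first.
  rewrite andbF [(l <= n)%N]leqNgt (ltnW ln) /= !add0r /C' /C.
  case: l lN lm ln => [|l lN lm ln]; first by rewrite mulr0.
  by case: ifP => [h|_]; [exfalso; lia|rewrite mulr0].
rewrite andbT trinomial_pascal; last lia.
have -> : (m.+1 + n.+1 - l = (m.+1 + n.+1 - l).-1.+1)%N by lia.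
rewrite exprS mulrCA; congr (t * _); rewrite !mulrDl; congr (_ + _ + _).
- case: (leqP l m) => h; last first.
    by have -> : (m.+1 - l = 0)%N by [lia]; rewrite mul0r.
  by rewrite subSn//; congr (_ * t ^+ _); lia.
- case: (leqP l n) => h; last first.
    by have -> : (n.+1 - l = 0)%N by [lia]; rewrite mul0r.
  by rewrite (subSn h); congr (_ * t ^+ _); lia.
- rewrite /C' /C; case: l lN lm ln => [|l lN lm ln]; first by rewrite mul0r.
  have -> : (l <= m)%N && (l <= n)%N by rewrite -ltnS lm -ltnS ln.
  by congr (trinomial _ _ _ _ * t ^+ _); lia.
Qed.

(** * Counting Player B's moves *)

(* Number of ways for Player B to make [s] nonzero moves from [b] M&M's, among
   the moves [d1], [d2] and [d1 + d2], and be left with between 1 and [D].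
   Truncation is harmless: once at 0 the count is 0 ([move_count0]). *)
Fixpoint move_count (R : realType) (d1 d2 D s b : nat) : R :=
  if s is s'.+1 then
    move_count R d1 d2 D s' (b - d1) + move_count R d1 d2 D s' (b - d2) +
    move_count R d1 d2 D s' (b - (d1 + d2))
  else (1 <= b <= D)%N%:R.

Lemma move_count0 (R : realType) (d1 d2 D s : nat) :
  move_count R d1 d2 D s 0 = 0.
Proof. by elim: s => //= s ->; rewrite !addr0. Qed.

(** Here [i], [j], [k] count the moves [d1], [d2], [d1 + d2], and the trinomial coefficient counts
    their orders. Removing the first move gives the same recurrence in [s] on both sides. *)
Lemma move_countE (R : realType) (d1 d2 D s b N : nat) : (s < N)%N ->
  move_count R d1 d2 D s b =
  \sum_(i < N) \sum_(j < N) \sum_(k < N)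
    (if (i + j + k == s)%N then trinomial R i j k *
       (1 <= b - d1 * (i + k) - d2 * (j + k) <= D)%N%:R else 0).
Proof.
elim: s b => [|s IHs] b sN.
  case: N sN => // N _.
  rewrite big_ord_recl/= [X in _ + X]big1 ?addr0; last first.
    by move=> i _; rewrite big1// => j _; rewrite big1.
  rewrite big_ord_recl/= [X in _ + X]big1 ?addr0; last first.
    by move=> j _; rewrite big1.
  rewrite big_ord_recl/= [X in _ + X]big1 ?addr0//.
  by rewrite !muln0 !subn0 /trinomial divff ?mul1r// pnatr_eq0.
rewrite (trinomial_sumS (fun i j k =>
  (1 <= b - d1 * (i + k) - d2 * (j + k) <= D)%N%:R) sN) /= !IHs; try lia.
congr (_ + _ + _); do 3 (apply: eq_bigr => ? _); case: ifP => // _;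
  congr (_ * (_ <= _ <= _)%N%:R); rewrite -!subnDA; congr (b - _)%N; lia.
Qed.

Lemma fsum_triples (V : nmodType) (N : nat) (A : set (nat * nat * nat))
    (F : nat * nat * nat -> V) :
  (forall i j k, A (i, j, k) -> [/\ i < N, j < N & k < N]%N) ->
  \sum_(x \in A) F x = \sum_(i < N) \sum_(j < N) \sum_(k < N)
    (if (nat_of_ord i, nat_of_ord j, nat_of_ord k) \in A
     then F (nat_of_ord i, nat_of_ord j, nat_of_ord k) else 0).
Proof.
move=> AN; rewrite fsbig_mkcond.
pose f (x : 'I_N * 'I_N * 'I_N) :=
  (nat_of_ord x.1.1, nat_of_ord x.1.2, nat_of_ord x.2).
have f_inj : injective f.
  move=> [[i j] k] [[i' j'] k'] [] e1 e2 e3.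
  by congr (_, _, _); exact: val_inj.
(* The summand is now 0 off [A], so only the image of the cube contributes. *)
rewrite -(@fsbig_widen _ _ _ _ [set` map f (index_enum _)]) //; last first.
  move=> [[i j] k] /= [_ nr]; rewrite /patch; case: ifPn => // /set_mem.
  move=> /AN[iN jN kN]; case: nr.
  apply/mapP; exists (Ordinal iN, Ordinal jN, Ordinal kN) => //.
  exact: mem_index_enum.
rewrite -fsbig_seq ?map_inj_uniq ?index_enum_uniq// big_map.
by rewrite 2!pair_bigA; apply: eq_bigr => -[[i j] k] _; rewrite /patch.
Qed.

(** The triples are grouped by their number [s] of moves. Each move costs at least 1 and at least 1
    remains, so [s < b <= N]. *)
Lemma sum_index_triplesE (R : realType) (d1 d2 D b N : nat) (phi : nat -> R) :
  (0 < d1)%N -> (0 < d2)%N -> (b <= N)%N ->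
  \sum_(x \in index_triples d1 d2 b D)
    (let: (i, j, k) := x in trinomial R i j k * phi (i + j + k)%N) =
  \sum_(s < N) move_count R d1 d2 D s b * phi s.
Proof.
move=> d1_gt0 d2_gt0 bN.
have lt_N i j k : index_triples d1 d2 b D (i, j, k) -> (i + j + k < N)%N.
  move=> /= /andP[h _].
  have h1 : (i + k <= d1 * (i + k))%N by rewrite leq_pmull.
  have h2 : (j + k <= d2 * (j + k))%N by rewrite leq_pmull.
  lia.
rewrite (@fsum_triples _ N); last by move=> i j k /lt_N; split; lia.
under [RHS]eq_bigr => s _.
  rewrite (move_countE _ _ _ _ _ (ltn_ord s)) mulr_suml.
  under eq_bigr do rewrite mulr_suml.
  under eq_bigr do under eq_bigr do rewrite mulr_suml.
  over.
rewrite [RHS]exchange_big; apply: eq_bigr => i _.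
rewrite [RHS]exchange_big; apply: eq_bigr => j _.
rewrite [RHS]exchange_big; apply: eq_bigr => k _.
case: ifPn => [/set_mem ijk|/negP nijk].
  rewrite (bigD1 (Ordinal (lt_N _ _ _ ijk)))// ifT; last exact: eqxx.
  rewrite /= [X in _ + X]big1 ?addr0; last first.
    move=> s /negP ns; case: eqP => [e|]; last by rewrite mul0r.
    by case: ns; apply/eqP/val_inj.
  by move: ijk; rewrite /index_triples /= => ->; rewrite mulr1.
rewrite big1// => s _; case: ifP => _; last by rewrite mul0r.
case: (boolP (_ <= _ <= _)%N) => h; last by rewrite mulr0 mul0r.
by case: nijk; apply/mem_set.
Qed.

(** The share of the last move [D] in the right-hand side. For positive [d1], [d2], every [N >= b]
    gives the same value by [sum_index_triplesE]; a free [N] can drop by one with each move of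
    Player B. *)
Definition move_sum (R : realType) (t : R) (d1 d2 D m N b : nat) : R :=
  \sum_(s < N) move_count R d1 d2 D s b * delannoy m s t.

Lemma move_sum_b0 (R : realType) (t : R) (d1 d2 D m N : nat) :
  move_sum t d1 d2 D m N 0 = 0.
Proof. by rewrite /move_sum big1// => s _; rewrite move_count0 mul0r. Qed.

Lemma move_sum0 (R : realType) (t : R) (d1 d2 D N b : nat) :
  move_sum t d1 d2 D 0 N.+1 b = (1 <= b <= D)%N%:R +
    t * (move_sum t d1 d2 D 0 N (b - d1) + move_sum t d1 d2 D 0 N (b - d2) +
         move_sum t d1 d2 D 0 N (b - (d1 + d2))).
Proof.
rewrite /move_sum big_ord_recl /= delannoy0n expr0 mulr1; congr (_ + _).
rewrite -!big_split/= big_distrr/=; apply: eq_bigr => s _.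
by rewrite !delannoy0n /bump /= add0n exprS; ring.
Qed.

(** The term [s = 0] is [t] times that of [S m N.+1 b]. In the others [delannoySS] separates moves
    of A alone, B alone and both, and [move_count] opens B's move in three ways: seven successors in
    all. *)
Lemma move_sumS (R : realType) (t : R) (d1 d2 D m N b : nat) :
  let S m' N' b' := move_sum t d1 d2 D m' N' b' in
  S m.+1 N.+1 b = t * (S m N.+1 b +
    ((S m N (b - d1)%N + S m.+1 N (b - d1)%N) +
     (S m N (b - d2)%N + S m.+1 N (b - d2)%N) +
     (S m N (b - (d1 + d2))%N + S m.+1 N (b - (d1 + d2))%N))).
Proof.
move=> S; rewrite /S /move_sum big_ord_recl /=.
rewrite [X in t * (X + _)]big_ord_recl /=.
rewrite !delannoym0 -addrA mulrDr exprS; congr (_ + _); first by ring.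
rewrite -!big_split/= big_distrr/=; apply: eq_bigr => s _.
by rewrite /bump /= add0n delannoySS; ring.
Qed.

(** * The game over finitely many rounds *)

Definition coins_of (x : bool * bool * bool) (c : coin) : bool :=
  match c with CoinA => x.1.1 | CoinB1 => x.1.2 | CoinB2 => x.2 end.

Definition round_state (d d1 d2 : nat) (s : nat * nat)
    (x : bool * bool * bool) : nat * nat :=
  if game_over s then s else play_round d d1 d2 (coins_of x) s.

(** Finite-horizon tie probability, free of measure theory; [cylinder_tie] links it to [P]. *)
Fixpoint tie_prob (R : realType) (d d1 d2 n : nat) (s : nat * nat) : R :=
  if n is m.+1 then
    8^-1 * \sum_(x : bool * bool * bool)
      tie_prob R d d1 d2 m (round_state d d1 d2 s x)
  else (s == (0, 0))%N%:R.

Lemma game2_state_eq (d d1 d2 I1 I2 n : nat) (h h' : nat * coin -> bool) :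
  (forall i, (i.1 < n)%N -> h i = h' i) ->
  game2_state d d1 d2 I1 I2 h n = game2_state d d1 d2 I1 I2 h' n.
Proof.
elim: n => //= n IHn hh'; rewrite IHn; last by move=> i /ltnW/hh'.
by rewrite /play_round !hh'.
Qed.

Definition set_round (h : nat * coin -> bool) (n : nat)
    (x : bool * bool * bool) (i : nat * coin) : bool :=
  if i.1 == n then coins_of x i.2 else h i.

Lemma game2_state_set_round (d d1 d2 I1 I2 n : nat) (h : nat * coin -> bool)
    (x : bool * bool * bool) :
  game2_state d d1 d2 I1 I2 (set_round h n x) n.+1 =
  round_state d d1 d2 (game2_state d d1 d2 I1 I2 h n) x.
Proof.
rewrite /= (game2_state_eq _ _ _ _ _ (h' := h)); last first.
  by move=> i; rewrite /set_round; case: eqP => // ->; rewrite ltnn.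
by rewrite /round_state /play_round /set_round /= eqxx.
Qed.

(** * The tie event on the space of coin tosses *)

Section coins.
Context disp (T : measurableType disp) (R : realType) (P : probability T R).
Variable X : nat * coin -> {RV P >-> bool}.
Hypothesis X_fair : independent_fair_coins X.

Definition cylinder (n : nat) (h : nat * coin -> bool) : set T :=
  [set w | forall i, (i.1 < n)%N -> X i w = h i].

Lemma fair_coin_probability (i : nat * coin) (b : bool) :
  P (X i @^-1` [set b]) = (2^-1)%:E.
Proof.
have [_ hX] := X_fair; case: b; first exact: hX.
have -> : X i @^-1` [set false] = ~` (X i @^-1` [set true]).
  by apply/seteqP; split => w /=; case: (X i w).
rewrite probability_setC; last exact: measurable_funPTI.
by rewrite [P _]hX -EFinB; congr EFin; lra.
Qed.

(** Puts a cylinder in the form that [mutually_independent] applies to. *)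
Lemma cylinder_bigcap (n : nat) (h : nat * coin -> bool) :
  exists2 J : {fset nat * coin}, #|` J| = (3 * n)%N &
    cylinder n h = \bigcap_(i in [set` J]) (X i @^-1` [set h i]).
Proof.
pose s := [seq (m, c) | m <- iota 0 n, c <- [:: CoinA; CoinB1; CoinB2]].
exists [fset i in s]%fset.
  rewrite card_fseq undup_id ?size_allpairs ?size_iota 1?mulnC//.
  by apply: allpairs_uniq => //; [exact: iota_uniq|move=> [? ?] [? ?]].
have memJ i : (i \in [fset i in s]%fset) = (i.1 < n)%N.
  rewrite in_fset /=; apply/allpairsP/idP => [[[m c] [/= + _ ->]]|].
    by rewrite mem_iota.
  case: i => m c /= mn; exists (m, c); split => //=.
    by rewrite mem_iota.
  by case: c.
apply/seteqP; split => w /= hw i; first by rewrite /= memJ => /hw.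
by move=> im; apply: hw; rewrite /= memJ.
Qed.

Lemma measurable_cylinder n h : measurable (cylinder n h).
Proof.
have [J _ ->] := cylinder_bigcap n h.
by apply: fin_bigcap_measurable => // i _; exact: measurable_funPTI.
Qed.

Lemma probability_cylinder n h : P (cylinder n h) = (8^-1 ^+ n)%:E.
Proof.
have [J cardJ ->] := cylinder_bigcap n h.
have [X_indep _] := X_fair; rewrite X_indep//.
under eq_bigr do rewrite fair_coin_probability.
have -> : (8^-1 ^+ n = 2^-1 ^+ #|` J| :> R).
  by rewrite cardJ exprM; congr (_ ^+ n); rewrite exprVn -natrX.
elim: (enum_fset J) => [|i s IHs]; first by rewrite big_nil.
by rewrite big_cons IHs -EFinM /= exprS.
Qed.

Variables d d1 d2 I1 I2 : nat.
Let state := game2_state d d1 d2 I1 I2.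

(* Conditioning on the first [k] rounds avoids shifting the coin sequence: the
   game restarted after round [k] is the original one on the cylinder. *)
Lemma cylinder_tie (k n : nat) (h : nat * coin -> bool) :
  let E := cylinder k h `&`
    [set w | state (fun i => X i w) (k + n) = (0, 0)%N] in
  measurable E /\ P E = (8^-1 ^+ k * tie_prob R d d1 d2 n (state h k))%:E.
Proof.
elim: n k h => [|n IHn] k h E.
  (* With no round left, the cylinder already determines the state. *)
  have EE : E = if state h k == (0, 0)%N then cylinder k h else set0.
    rewrite /E; case: eqP => [s0|s0]; apply/seteqP; split => w //=.
    - by case.
    - by move=> hw; split => //; rewrite addn0 -s0; exact: game2_state_eq.
    - case=> hw; rewrite addn0 => sw; apply: s0; rewrite -sw.
      by apply: game2_state_eq => i /hw.
  rewrite EE /=; case: eqP => _; rewrite ?measure0 ?mulr0; split => //.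
    exact: measurable_cylinder.
  by rewrite mulr1 probability_cylinder.
(* The part of [E] where round [k] shows [x]; it has the shape of [E] with [k.+1] fixed rounds, as
   the induction hypothesis requires. *)
pose F x := cylinder k.+1 (set_round h k x) `&`
  [set w | state (fun i => X i w) (k.+1 + n) = (0, 0)%N].
have mF x : measurable (F x) by case: (IHn k.+1 (set_round h k x)).
have PF x : P (F x) = (8^-1 ^+ k.+1 *
    tie_prob R d d1 d2 n (round_state d d1 d2 (state h k) x))%:E.
  case: (IHn k.+1 (set_round h k x)) => _ ->.
  by rewrite /state game2_state_set_round.
have EF : E = \bigcup_(x in [set: bool * bool * bool]) F x.
  rewrite /E /F addnS addSn; apply/seteqP; split => w /=.
    case=> hw sw.
    exists (X (k, CoinA) w, X (k, CoinB1) w, X (k, CoinB2) w) => //.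
    split => // -[m c] /=; rewrite ltnS leq_eqVlt /set_round /=.
    case: eqP => [-> _|_ mk]; last exact: hw.
    by case: c.
  case=> x _ [hw sw]; split => // i ik; rewrite hw/=; last exact: ltnW.
  by rewrite /set_round; case: eqP ik => // ->; rewrite ltnn.
have tF : trivIset setT F.
  move=> x y _ _ [w [[xw _] [yw _]]].
  have xy c : coins_of x c = coins_of y c.
    have := xw (k, c) (ltnSn k); rewrite (yw (k, c) (ltnSn k)).
    by rewrite /set_round /= eqxx.
  case: x y xy {xw yw} => [[x1 x2] x3] [[y1 y2] y3] xy.
  by rewrite [x1](xy CoinA) [x2](xy CoinB1) [x3](xy CoinB2).
split; first by rewrite EF; apply: fin_bigcup_measurable.
rewrite EF measure_fin_bigcup//; last exact: finite_finset.
have -> : [set: bool * bool * bool] =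
    [set` index_enum (bool * bool * bool)%type].
  by apply/seteqP; split => x //= _; exact: mem_index_enum.
rewrite -fsbig_seq ?index_enum_uniq//.
transitivity (\sum_(x : bool * bool * bool) (8^-1 ^+ k.+1 *
    tie_prob R d d1 d2 n (round_state d d1 d2 (state h k) x))%:E)%E.
  by apply: eq_bigr => x _; exact: PF.
by rewrite sumEFin -big_distrr /= exprS mulrCA !mulrA.
Qed.

Lemma probability_state_tie (n : nat) :
  measurable [set w | state (fun i => X i w) n = (0, 0)%N] /\
  P [set w | state (fun i => X i w) n = (0, 0)%N] =
    (tie_prob R d d1 d2 n (I1, I2))%:E.
Proof.
have := cylinder_tie 0 n (fun=> true).
have -> : cylinder 0 (fun=> true) = setT by apply/seteqP; split.
by rewrite setTI expr0 mul1r.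
Qed.

Lemma game2_tie_bigcup :
  [set w | game2_tie d d1 d2 I1 I2 (fun i => X i w)] =
  \bigcup_n [set w | state (fun i => X i w) n = (0, 0)%N].
Proof. by apply/seteqP; split => w [n]; [exists n|exists n]. Qed.

Lemma measurable_tie :
  measurable [set w | game2_tie d d1 d2 I1 I2 (fun i => X i w)].
Proof.
rewrite game2_tie_bigcup.
by apply: bigcup_measurable => n _; case: (probability_state_tie n).
Qed.

(** The state [(0, 0)] is absorbing, so the events increase and continuity from below applies. *)
Lemma probability_tie_cvg :
  tie_prob R d d1 d2 n (I1, I2) @[n --> \oo] -->
  fine (P [set w | game2_tie d d1 d2 I1 I2 (fun i => X i w)]).
Proof.
have := measurable_tie; rewrite game2_tie_bigcup => mU.
pose F n := [set w | state (fun i => X i w) n = (0, 0)%N].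
have mF n : measurable (F n) by case: (probability_state_tie n).
have ndF : nondecreasing_seq F.
  apply/nondecreasing_seqP => n; apply/subsetPset => w.
  by rewrite /F /state /= => ->.
have FE n : P (F n) = (tie_prob R d d1 d2 n (I1, I2))%:E.
  by case: (probability_state_tie n).
have := nondecreasing_cvg_mu (mu := P) mF mU ndF.
rewrite (_ : P \o F = EFin \o tie_prob R d d1 d2 ^~ (I1, I2)); last first.
  by apply/funext => n; exact: FE.
by rewrite -[X in _ --> X]fineK ?fin_num_measure// => /fine_cvgP[_].
Qed.

End coins.

(** * The limiting tie probability and its recurrence *)

Lemma tie_prob_over (R : realType) (d d1 d2 n : nat) (s : nat * nat) :
  game_over s -> tie_prob R d d1 d2 n s = (s == (0, 0))%N%:R.
Proof.
elim: n s => //= n IHn s s_over; rewrite /round_state s_over IHn//.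
rewrite sumr_const !card_prod card_bool -[X in _ * X]mulr_natl.
by rewrite mulKf ?pnatr_eq0.
Qed.

Lemma tie_prob_le1 (R : realType) (d d1 d2 n : nat) (s : nat * nat) :
  tie_prob R d d1 d2 n s <= 1.
Proof.
elim: n s => /= [|n IHn] s; first by case: eqP.
rewrite -ler_pdivlMl ?invr_gt0// invrK mulr1.
apply: (@le_trans _ _ (\sum_(x : bool * bool * bool) 1)); first exact: ler_sum.
by rewrite sumr_const !card_prod card_bool.
Qed.

(** At [n = 0] the value is 0 except at the absorbing state [(0, 0)]; averaging then preserves
    monotonicity. *)
Lemma tie_prob_nondecreasing (R : realType) (d d1 d2 : nat) (s : nat * nat) :
  nondecreasing_seq (tie_prob R d d1 d2 ^~ s).
Proof.
apply/nondecreasing_seqP => n; elim: n s => [|n IHn] s.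
  case: (eqVneq s (0, 0)%N) => [->|/negPf s0].
    by rewrite !tie_prob_over.
  by rewrite /= s0 mulr_ge0 ?invr_ge0// sumr_ge0.
by rewrite [leRHS]/= [leLHS]/= ler_wpM2l ?invr_ge0// ler_sum.
Qed.

Definition tie_lim (R : realType) (d d1 d2 : nat) (s : nat * nat) : R :=
  limn (tie_prob R d d1 d2 ^~ s).

Lemma tie_lim_cvg (R : realType) (d d1 d2 : nat) (s : nat * nat) :
  tie_prob R d d1 d2 n s @[n --> \oo] --> tie_lim R d d1 d2 s.
Proof.
apply: nondecreasing_is_cvgn; first exact: tie_prob_nondecreasing.
by exists 1 => _ [n _ <-]; exact: tie_prob_le1.
Qed.

Lemma tie_lim_over (R : realType) (d d1 d2 : nat) (s : nat * nat) :
  game_over s -> tie_lim R d d1 d2 s = (s == (0, 0))%N%:R.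
Proof.
move=> s_over; apply: cvg_lim => //.
under eq_fun do rewrite tie_prob_over//.
exact: cvg_cst.
Qed.

(** Limit of the recursion defining [tie_prob]: a shifted sequence has the same limit. *)
Lemma tie_lim_round_state (R : realType) (d d1 d2 : nat) (s : nat * nat) :
  8 * tie_lim R d d1 d2 s =
  \sum_(x : bool * bool * bool) tie_lim R d d1 d2 (round_state d d1 d2 s x).
Proof.
apply: (mulfI (x := 8^-1)); first by rewrite invr_eq0 pnatr_eq0.
rewrite mulKf ?pnatr_eq0//.
have /cvg_lim <- // : tie_prob R d d1 d2 n.+1 s @[n --> \oo] -->
    8^-1 * \sum_(x : bool * bool * bool)
      tie_lim R d d1 d2 (round_state d d1 d2 s x).
  apply: cvgMl_tmp; apply: cvg_big => [|x _]; first exact: add_continuous.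
  exact: tie_lim_cvg.
apply/esym/cvg_lim => //; rewrite (cvg_shiftS (tie_prob R d d1 d2 ^~ s)).
exact: tie_lim_cvg.
Qed.

(** Three tails leave [(a, b)] unchanged; cancelling that term turns 8 into 7. *)
Lemma tie_lim_moves (R : realType) (d d1 d2 a b : nat) :
  (0 < a)%N -> (0 < b)%N ->
  let L a' b' := tie_lim R d d1 d2 (a', b') in
  7 * L a b = L (a - d)%N b +
    ((L (a - d)%N (b - d1)%N + L a (b - d1)%N) +
     (L (a - d)%N (b - d2)%N + L a (b - d2)%N) +
     (L (a - d)%N (b - (d1 + d2))%N + L a (b - (d1 + d2))%N)).
Proof.
move=> a_gt0 b_gt0 L; have := tie_lim_round_state R d d1 d2 (a, b).
have -> (f : bool * bool * bool -> R) : \sum_x f x =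
    \sum_(x : bool) \sum_(y : bool) \sum_(z : bool) f (x, y, z).
  by rewrite 2!pair_bigA; apply: eq_bigr => -[[]].
rewrite !big_bool /= /round_state /game_over /= !gtn_eqF//=.
rewrite /play_round /= !(addn0, add0n, subn0) /L => e; lra.
Qed.

(** * Solving the recurrence *)

(** Strong induction on [a + b], which every outcome but three tails lowers while both players have
    M&M's. *)
Lemma tie_limE (R : realType) (d d1 d2 a b N : nat) :
  (0 < d)%N -> (0 < d1)%N -> (0 < d2)%N -> (0 < a)%N -> (b <= N)%N ->
  let S D := move_sum (1 / 7 : R) d1 d2 D ((a - 1) %/ d) N b in
  tie_lim R d d1 d2 (a, b) = 1 / 7 * (S d1 + S d2 + S (d1 + d2)%N).
Proof.
move=> d_gt0 d1_gt0 d2_gt0.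
have [n] := ubnP (a + b); elim: n a b N => // n IHn a b N abn a_gt0 bN S.
have [b0|b_gt0] := posnP b.
  (* Player A still has M&M's, so this final state is not a tie. *)
  rewrite /S b0 !move_sum_b0 !addr0 mulr0 tie_lim_over.
    by rewrite xpair_eqE gtn_eqF.
  by rewrite /game_over orbT.
case: N bN @S => [|N bN S]; first by rewrite leqn0 gtn_eqF.
have L0 b' : tie_lim R d d1 d2 (0%N, b') = (b' == 0)%N%:R.
  by rewrite tie_lim_over ?xpair_eqE.
have := @tie_lim_moves R d d1 d2 a b a_gt0 b_gt0.
cbv beta zeta.
rewrite (IHn a (b - d1)%N N) ?(IHn a (b - d2)%N N)
  ?(IHn a (b - (d1 + d2))%N N); try lia.
(* If [a <= d], heads finishes Player A, and B's move [D] then ties exactly when [b <= D]: this is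
   the constant term of [move_sum0], once for each of the three moves. *)
case: (leqP a d) => ad.
  have -> : (a - d = 0)%N by lia.
  rewrite !L0 /S divn_small; last lia.
  rewrite !move_sum0 gtn_eqF// !subn_eq0 b_gt0 /=; lra.
rewrite (IHn (a - d)%N b N.+1) ?(IHn (a - d)%N (b - d1)%N N)
  ?(IHn (a - d)%N (b - d2)%N N) ?(IHn (a - d)%N (b - (d1 + d2))%N N); try lia.
(* If [d < a], heads for Player A lowers the first Delannoy index by exactly one. *)
have am : ((a - 1) %/ d = ((a - d) - 1) %/ d + 1)%N.
  rewrite -[in LHS](subnK (ltnW ad)) -addnBAC; last lia.
  by rewrite divnDr ?divnn ?d_gt0.
rewrite /S am addn1 !move_sumS; lra.
Qed.

Theorem theorem2p5 (R : realType) (disp : measure_display)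
    (Omega : measurableType disp) (P : probability Omega R)
    (X : nat * coin -> {RV P >-> bool})
    (d d1 d2 I1 I2 : nat) :
  independent_fair_coins X ->
  (0 < d)%N -> (0 < d1)%N -> (0 < d2)%N -> (0 < I1)%N -> (0 < I2)%N ->
  P [set w | game2_tie d d1 d2 I1 I2 (fun i => X i w)] =
    ((1 / 7%:R : R) *
     \sum_(D <- eat_pairs d d1 d2)
       \sum_(x \in index_triples d1 d2 I2 D.2)
         (let: (i, j, k) := x in
          trinomial R i j k *
          delannoy ((I1 - 1) %/ d) (i + j + k) (1 / 7%:R)))%:E.
Proof.
move=> X_fair d_gt0 d1_gt0 d2_gt0 I1_gt0 I2_gt0.
rewrite -[LHS]fineK; last first.
  by apply: fin_num_measure; exact: measurable_tie.
congr EFin.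
(* The same sequence [tie_prob] converges to both the tie probability and [tie_lim]. *)
rewrite -(cvg_unique _ (@tie_lim_cvg R d d1 d2 (I1, I2))
  (@probability_tie_cvg _ _ _ _ _ X_fair d d1 d2 I1 I2)) //.
rewrite (@tie_limE _ _ _ _ _ _ I2)//.
rewrite /eat_pairs /= !big_cons big_nil addr0 addrA.
have sumE D := @sum_index_triplesE R d1 d2 D I2 I2
  (fun s => delannoy ((I1 - 1) %/ d) s (1 / 7)) d1_gt0 d2_gt0 (leqnn I2).
by rewrite !sumE.
Qed.
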